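(* (1) The sequences $(a_n)_{n\ge0}$, $(b_n)_{n\ge0}$ given by $$b_0:=0,\qquad b_n:=\frac{(-1)^n(q;q^2)_{n-1}}{(q)_{2n-1}}\quad(n\ge1),$$ $$a_{2n}:=(1-q^{4n})\,q^{2n^2-2n}\sum_{j=-n}^{n-1}q^{-2j^2-2j},\qquad a_{2n+1}:=-(1-q^{4n+2})\,q^{2n^2}\sum_{|j|\le n}q^{-2j^2}\quad(n\ge0)$$ form a Bailey pair relative to $a=1$ (with $\alpha_n=a_n$, $\beta_n=b_n$). (2) The sequences $(\alpha_n)_{n\ge0}$, $(\beta_n)_{n\ge0}$ given for $n\ge0$ by $$\beta_n:=\frac{(-1)^n(q;q^2)_n}{(q)_{2n+1}},$$ $$\alpha_{2n}:=\frac{1}{1-q}\left(q^{2n^2+2n}\sum_{-n\le j\le n-1}q^{-2j^2-2j}+q^{2n^2}\sum_{|j|\le n}q^{-2j^2}\right),$$ $$\alpha_{2n+1}:=-\frac{1}{1-q}\left(q^{2n^2+4n+2}\sum_{|j|\le n}q^{-2j^2}+q^{2n^2+2n}\sum_{-n-1\le j\le n}q^{-2j^2-2j}\right)$$ form a Bailey pair relative to $a=q$.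
   Context: All quantities are rational functions of the variable $q$; sums over $j$ run over integers and an empty sum is $0$. Notation: $(a;q)_n:=\prod_{j=0}^{n-1}(1-aq^j)$ and $(a)_n:=(a;q)_n$; thus $(q)_n=\prod_{j=1}^n(1-q^j)$ and $(q;q^2)_n=\prod_{j=0}^{n-1}(1-q^{2j+1})$. Two sequences $\{\alpha_n\}_{n\ge0}$ and $\{\beta_n\}_{n\ge0}$ form a Bailey pair relative to $a$ if for all $n\ge0$ $$\beta_n=\sum_{r=0}^n\frac{\alpha_r}{(q)_{n-r}(aq)_{n+r}}.$$ *)

(* Defs.v *)
From mathcomp Require Import all_boot all_order all_algebra.

Set Implicit Arguments.
Unset Strict Implicit.
Unset Printing Implicit Defensive.

Import Order.TTheory GRing.Theory Num.Theory.
Local Open Scope ring_scope.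

Definition ratfun := {fraction {poly rat}}.

Definition q : ratfun := FracField.tofrac 'X.

(* (a; p)_n *)
Definition qpoch (a p : ratfun) (n : nat) : ratfun :=
  \prod_(0 <= j < n) (1 - a * p ^+ j).

Definition bailey_pair (a : ratfun) (alpha beta : nat -> ratfun) : Prop :=
  forall n : nat,
    beta n =
    \sum_(0 <= r < n.+1) alpha r / (qpoch q q (n - r) * qpoch (a * q) q (n + r)).

(* The integers j with lo <= j <= hi, in increasing order; empty if hi < lo. *)
Definition zrange (lo hi : int) : seq int :=
  if lo <= hi then [seq lo + i%:Z | i <- iota 0 `|hi - lo|%N.+1] else [::].

(* Exponents of q are integers, and may be negative in the sums over j. *)

Definition a1_even (n : nat) : ratfun :=
  (1 - q ^ (4 * n%:Z)) * q ^ (2 * n%:Z ^+ 2 - 2 * n%:Z) *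
  \sum_(j <- zrange (- n%:Z) (n%:Z - 1)) q ^ (- 2 * j ^+ 2 - 2 * j).

Definition a1_odd (n : nat) : ratfun :=
  - (1 - q ^ (4 * n%:Z + 2)) * q ^ (2 * n%:Z ^+ 2) *
  \sum_(j <- zrange (- n%:Z) n%:Z) q ^ (- 2 * j ^+ 2).

(* m = 2n or m = 2n + 1, with n = m./2 *)
Definition a1 (m : nat) : ratfun :=
  if odd m then a1_odd m./2 else a1_even m./2.

Definition b1 (n : nat) : ratfun :=
  if n == 0%N then 0
  else (-1) ^+ n * qpoch q (q ^+ 2) (n - 1) / qpoch q q (2 * n - 1).

Definition alpha2_even (n : nat) : ratfun :=
  1 / (1 - q) *
  (q ^ (2 * n%:Z ^+ 2 + 2 * n%:Z) *
     (\sum_(j <- zrange (- n%:Z) (n%:Z - 1)) q ^ (- 2 * j ^+ 2 - 2 * j))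
   + q ^ (2 * n%:Z ^+ 2) *
     (\sum_(j <- zrange (- n%:Z) n%:Z) q ^ (- 2 * j ^+ 2))).

Definition alpha2_odd (n : nat) : ratfun :=
  - (1 / (1 - q)) *
  (q ^ (2 * n%:Z ^+ 2 + 4 * n%:Z + 2) *
     (\sum_(j <- zrange (- n%:Z) n%:Z) q ^ (- 2 * j ^+ 2))
   + q ^ (2 * n%:Z ^+ 2 + 2 * n%:Z) *
     (\sum_(j <- zrange (- n%:Z - 1) n%:Z) q ^ (- 2 * j ^+ 2 - 2 * j))).

Definition alpha2 (m : nat) : ratfun :=
  if odd m then alpha2_odd m./2 else alpha2_even m./2.

Definition beta2 (n : nat) : ratfun :=
  (-1) ^+ n * qpoch q (q ^+ 2) n / qpoch q q (2 * n + 1).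

(* Main.v *)
Require Import Defs.
From mathcomp Require Import all_boot all_order all_algebra.
From mathcomp Require Import ring zify.
Set Implicit Arguments.
Unset Strict Implicit.
Unset Printing Implicit Defensive.
Import GRing.Theory.
Local Open Scope ring_scope.

(** Write both pairs in terms of a single sequence A_m ([weighted_theta]), the
    inner sums over j with their outer power of q and the sign (-1)^m:
    a_m = (1 - q^(2m)) A_m and (1 - q) alpha_m = q^(2m) A_m - A_(m+1).
    Passing from m to m+2 adds two equal terms at the ends of the inner sum, so
    A_(m+2) = q^(2m) A_m + 2 (-1)^m, with A_0 = 0 and A_1 = -1.  This recurrence
    is all that is used about A ([kern_pairing]).

    Let K_r(n) = 1/((q)_(n-r) (q)_(n+r)), with K_r(n) = 0 for r > n.  The
    contiguous relation
      (1 - q^(2n-1)) (1 - q^(2r)) K_r(n) = K_(r-1)(n-1) - q^(2r) K_(r+1)(n-1)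
    ([kern_contiguous]) turns the sum of a_r K_r(n), after summation by parts,
    into a sum whose coefficients are A_(r+2) - q^(2r) A_r = 2 (-1)^r.  Hence
    (1 - q^(2n-1)) times the right-hand side of the Bailey relation at n is
    minus the alternating sum of K_s(n-1) over all integers s, |s| <= n-1.
    By Gauss's evaluation of the alternating sum of q-binomial coefficients
    this sum is (-1)^(n-1)/(q^2;q^2)_(n-1) ([alt_sum_full]), which is the stated
    value of b_n because (q)_(2n-1) = (q;q^2)_n (q^2;q^2)_(n-1).

    The second pair is the first one in disguise: beta_n = - b_(n+1), and
    splitting (1 - q^(2r)) K_r(n+1) into two consecutive values of the kernel
    relative to q ([kern_split]) turns the relation for a at n+1 into the one
    for alpha at n ([sum_kern_split]).

    The argument only needs a nonzero element of a field that is not a root of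
    unity; q in the field of rational functions is one. *)

(** * Inverse q-factorials *)

Definition not_root_of_unity (F : fieldType) (x : F) : Prop :=
  forall k, 1 - x ^+ k.+1 != 0.

Definition qfact (F : fieldType) (x : F) (n : nat) : F :=
  \prod_(0 <= j < n) (1 - x ^+ j.+1).

Lemma qfact0 (F : fieldType) (x : F) : qfact x 0 = 1.
Proof. by rewrite /qfact big_geq. Qed.

Lemma qfactS (F : fieldType) (x : F) n :
  qfact x n.+1 = qfact x n * (1 - x ^+ n.+1).
Proof. by rewrite /qfact big_nat_recr. Qed.

Lemma qfact_neq0 (F : fieldType) (x : F) n :
  not_root_of_unity x -> qfact x n != 0.
Proof.
move=> xP; elim: n => [|n IHn]; first by rewrite qfact0 oner_neq0.
by rewrite qfactS mulf_neq0.
Qed.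

(** The odd and the even factors of (x)_(2m+1). *)
Lemma qfact_double (F : fieldType) (x : F) m :
  qfact x (2 * m).+1 = \prod_(0 <= j < m.+1) (1 - x * (x ^+ 2) ^+ j) * qfact (x ^+ 2) m.
Proof.
elim: m => [|m IHm].
  by rewrite big_nat1 qfactS !qfact0 mul1r expr0 !mulr1.
have -> : ((2 * m.+1).+1 = (2 * m).+3)%N by lia.
rewrite 2!qfactS IHm [in RHS]big_nat_recr //= (qfactS _ m) -!exprM -exprS.
have -> : ((2 * m).+3 = (2 * m.+1).+1)%N by lia.
have -> : ((2 * m).+2 = 2 * m.+1)%N by lia.
by rewrite -!mulrA; congr (_ * _); rewrite mulrA mulrC.
Qed.

(** The closed form of b_(m+1), with the q-Pochhammer symbols to base x^2 that
    Gauss's sum produces. *)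
Lemma odd_qfact_ratio (F : fieldType) (x : F) m :
  not_root_of_unity x ->
  (-1) ^+ m.+1 * \prod_(0 <= j < m) (1 - x * (x ^+ 2) ^+ j) / qfact x (2 * m).+1 =
  - ((-1) ^+ m / qfact (x ^+ 2) m) / (1 - x ^+ (2 * m).+1).
Proof.
move=> xP; rewrite qfact_double big_nat_recr //= -exprM -exprS (exprS (-1)).
have := xP (2 * m)%N.
have : qfact (x ^+ 2) m != 0.
  by apply: qfact_neq0 => k; rewrite -exprM mul2n doubleS.
have : \prod_(0 <= j < m) (1 - x * (x ^+ 2) ^+ j) != 0.
  by rewrite prodf_seq_neq0; apply/allP => j _ /=; rewrite -exprM -exprS.
move: (1 - _) (qfact _ _) (\prod_(_ <= _ < _) _) ((-1) ^+ m) => a b c s c0 b0 a0.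
by field; rewrite a0 b0 c0.
Qed.

(** 1/(x)_(n-r), extended by 0 to r > n as the q-Pochhammer symbol of negative
    index dictates; with this extension [inv_qfact_recr] has no boundary case. *)
Definition inv_qfact (F : fieldType) (x : F) (n r : nat) : F :=
  if (r <= n)%N then (qfact x (n - r))^-1 else 0.

Lemma inv_qfactSS (F : fieldType) (x : F) n r :
  inv_qfact x n.+1 r.+1 = inv_qfact x n r.
Proof. by rewrite /inv_qfact ltnS subSS. Qed.

Lemma inv_qfact_recr (F : fieldType) (x : F) n r :
  not_root_of_unity x ->
  x ^+ r * inv_qfact x n r.+1 = (x ^+ r - x ^+ n) * inv_qfact x n r.
Proof.
move=> xP; rewrite /inv_qfact; case: (ltngtP r n) => [lt_rn | lt_nr | ->].
- have /subnKC <- := lt_rn; move: (n - r.+1)%N => k.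
  have -> : (r.+1 + k - r.+1 = k)%N by lia.
  have -> : (r.+1 + k - r = k.+1)%N by lia.
  rewrite qfactS addSnnS exprD.
  have := xP k; have := qfact_neq0 k xP.
  move: (x ^+ k.+1) (qfact x k) (x ^+ r) => y c z c0 y0.
  by field; rewrite y0 c0.
- by rewrite !mulr0.
- by rewrite subrr mul0r mulr0.
Qed.

(** * The Bailey kernel and its contiguous relations *)

(** Up to the factor (x)_s, the kernel of Bailey pairs relative to x^s.  Since
    it vanishes for r > n, sums over r telescope without boundary terms at the
    top. *)
Definition kern (F : fieldType) (x : F) (s n r : nat) : F :=
  inv_qfact x n r / qfact x (n + r + s).

Lemma kern_gt (F : fieldType) (x : F) s n r : (n < r)%N -> kern x s n r = 0.
Proof. by rewrite /kern /inv_qfact ltnNge => /negbTE->; rewrite mul0r. Qed.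

Lemma kernE (F : fieldType) (x : F) s n r : (r <= n)%N ->
  kern x s n r = (qfact x (n - r) * qfact x (n + r + s))^-1.
Proof. by rewrite /kern /inv_qfact => ->; rewrite -invfM. Qed.

(** With N = x^m and X = x^r, clearing denominators leaves
    (1 - xNX)(1 - x^2 NX) - x(xX - N)(X - N) = (1 - x^2 X^2)(1 - x N^2):
    the terms linear in NX cancel and the rest factors, which separates the
    dependence on m from the dependence on r. *)
Lemma kern_contiguous (F : fieldType) (x : F) m r :
  not_root_of_unity x ->
  (1 - x ^+ (2 * m).+1) * ((1 - x ^+ (2 * r.+1)) * kern x 0 m.+1 r.+1) =
  kern x 0 m r - x ^+ (2 * r.+1) * kern x 0 m r.+2.
Proof.
move=> xP; rewrite /kern inv_qfactSS !addn0 !addnS !addSn !qfactS.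
have := inv_qfact_recr m r xP; have := inv_qfact_recr m r.+1 xP.
have := qfact_neq0 (m + r) xP.
have := xP (m + r)%N; have := xP (m + r).+1.
rewrite !(mulnC 2%N) !exprS !exprM exprD !exprS.
move: (inv_qfact x m r.+2) (inv_qfact x m r.+1) (inv_qfact x m r).
move: (qfact x (m + r)) (x ^+ m) (x ^+ r) => c N X i2 i1 i0 n2 n1 c0 e2 e1.
(* Two steps of the recurrence, from r.+2 down to r, without dividing by X. *)
have e : x * X ^+ 2 * i2 = (x * X - N) * (X - N) * i0.
  by transitivity (X * (x * X * i2)); [ring | rewrite e2 mulrCA e1 mulrA].
apply/eqP; rewrite -subr_eq0; apply/eqP.
transitivity (x * (x * X ^+ 2 * i2 - (x * X - N) * (X - N) * i0) /
              (c * (1 - x * (N * X)) * (1 - x * (x * (N * X))))).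
  by field; rewrite n2 n1 c0.
by rewrite e subrr mulr0 mul0r.
Qed.

(** The kernel relative to 1 in terms of the kernel relative to x, one level
    lower.  The factor 1 - x^(2r) is what makes two terms suffice, and it is the
    one that occurs in the first pair. *)
Lemma kern_split (F : fieldType) (x : F) m r :
  not_root_of_unity x ->
  (1 - x ^+ (2 * r.+1)) * kern x 0 m.+1 r.+1 =
  kern x 1 m r - x ^+ (2 * r.+1) * kern x 1 m r.+1.
Proof.
move=> xP; rewrite /kern inv_qfactSS !addn0 addn1 !addnS !addSn !addn0 !qfactS.
have := inv_qfact_recr m r xP.
have := qfact_neq0 (m + r) xP.
have := xP (m + r)%N; have := xP (m + r).+1.
rewrite !(mulnC 2%N) !exprS !exprM exprD !exprS.
move: (inv_qfact x m r.+1) (inv_qfact x m r).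
move: (qfact x (m + r)) (x ^+ m) (x ^+ r) => c N X i1 i0 n2 n1 c0 e1.
apply/eqP; rewrite -subr_eq0; apply/eqP.
transitivity (x ^+ 2 * X * (X * i1 - (X - N) * i0) /
              (c * (1 - x * (N * X)) * (1 - x * (x * (N * X))))).
  by field; rewrite n2 n1 c0.
by rewrite e1 subrr mulr0 mul0r.
Qed.

(** * Gauss's alternating sum *)

(** The case r = 0 of [kern_level_step]: by the symmetry of the kernel, the
    term of index -1 on the right equals the term of index 0. *)
Lemma kern_level_step0 (F : fieldType) (x : F) m :
  not_root_of_unity x ->
  (1 - x ^+ (2 * m.+1)) * kern x 0 m.+1 0 + kern x 0 m 0 = 2 * kern x 1 m 0.
Proof.
move=> xP; rewrite !kernE // !subn0 !addn0 addn1 !qfactS.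
have := qfact_neq0 m xP; have := xP m; rewrite mulnC exprM.
move: (qfact x m) (x ^+ m.+1) => c N n1 c0.
by field; rewrite n1 c0.
Qed.

(** The right-hand side is a sum of two neighbours, so it telescopes once
    multiplied by (-1)^r; this relates the alternating sums at levels m and
    m+1. *)
Lemma kern_level_step (F : fieldType) (x : F) m r :
  not_root_of_unity x ->
  (1 - x ^+ (2 * m.+1)) * kern x 0 m.+1 r.+1 + kern x 0 m r.+1 =
  kern x 1 m r + kern x 1 m r.+1.
Proof.
move=> xP; rewrite /kern inv_qfactSS !addn0 addn1 !addnS !addSn !addn0 !qfactS.
have := inv_qfact_recr m r xP.
have := qfact_neq0 (m + r) xP.
have := xP (m + r)%N; have := xP (m + r).+1.
rewrite !(mulnC 2%N) !exprS !exprM exprD !exprS.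
move: (inv_qfact x m r.+1) (inv_qfact x m r).
move: (qfact x (m + r)) (x ^+ m) (x ^+ r) => c N X i1 i0 n2 n1 c0 e1.
apply/eqP; rewrite -subr_eq0; apply/eqP.
transitivity (x ^+ 2 * N * ((X - N) * i0 - X * i1) /
              (c * (1 - x * (N * X)) * (1 - x * (x * (N * X))))).
  by field; rewrite n2 n1 c0.
by rewrite -e1 subrr mulr0 mul0r.
Qed.

(** The sum of (-1)^s K_s(m) over |s| <= R, folded by the symmetry s -> -s. *)
Definition alt_sum (F : fieldType) (x : F) (m R : nat) : F :=
  kern x 0 m 0 + 2 * \sum_(0 <= s < R) (-1) ^+ s.+1 * kern x 0 m s.+1.

Lemma alt_sum0 (F : fieldType) (x : F) m : alt_sum x m 0 = kern x 0 m 0.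
Proof. by rewrite /alt_sum big_geq // mulr0 addr0. Qed.

Lemma alt_sumS (F : fieldType) (x : F) m R :
  alt_sum x m R.+1 = alt_sum x m R + 2 * ((-1) ^+ R.+1 * kern x 0 m R.+1).
Proof. by rewrite /alt_sum big_nat_recr //= mulrDr addrA. Qed.

Lemma alt_sum_step (F : fieldType) (x : F) m R :
  not_root_of_unity x ->
  (1 - x ^+ (2 * m.+1)) * alt_sum x m.+1 R + alt_sum x m R =
  2 * ((-1) ^+ R * kern x 1 m R).
Proof.
move=> xP; elim: R => [|R IHR].
  by rewrite !alt_sum0 kern_level_step0 // expr0 mul1r.
rewrite !alt_sumS.
transitivity ((1 - x ^+ (2 * m.+1)) * alt_sum x m.+1 R + alt_sum x m R
  + 2 * ((-1) ^+ R.+1 * ((1 - x ^+ (2 * m.+1)) * kern x 0 m.+1 R.+1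
                         + kern x 0 m R.+1))).
  by move: (1 - _) ((-1) ^+ _) (alt_sum _ _ _) => a b c; ring.
rewrite IHR kern_level_step // exprS.
by move: ((-1) ^+ R) => a; ring.
Qed.

(** At R = m+1 the boundary term of [alt_sum_step] vanishes, so the complete
    sums satisfy a first-order recurrence in m.  Multiplied by (x)_(2m), this is
    Gauss's formula for the alternating sum of the q-binomial coefficients
    of 2m. *)
Lemma alt_sum_full (F : fieldType) (x : F) m :
  not_root_of_unity x ->
  alt_sum x m m = (-1) ^+ m / qfact (x ^+ 2) m.
Proof.
move=> xP; elim: m => [|m IHm].
  by rewrite alt_sum0 kernE // !qfact0 expr0 !mul1r.
have := alt_sum_step m m.+1 xP.
rewrite kern_gt // !mulr0 (alt_sumS x m) kern_gt // !mulr0 addr0 => /eqP.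
rewrite addr_eq0 IHm qfactS -exprM => /eqP e.
have n0 : 1 - x ^+ (2 * m.+1) != 0 by rewrite mul2n doubleS; apply: xP.
apply: (mulfI n0); rewrite e (exprS (-1)) invfM.
by move: (qfact _ _)^-1 ((-1) ^+ m) (1 - x ^+ _) n0 => a b c c0; field.
Qed.

(** * Summation by parts against the kernel *)

(** By [kern_contiguous] the recurrence of A is the adjoint of the factor
    1 - x^(2r) in the kernel: moving the shifts from the kernel to A leaves only
    the inhomogeneous terms 2 (-1)^r, that is, the alternating sum. *)
Lemma kern_pairing (F : fieldType) (x : F) (A : nat -> F) m :
  not_root_of_unity x ->
  A 0%N = 0 -> A 1%N = -1 ->
  (forall r, A r.+2 = x ^+ (2 * r) * A r + 2 * (-1) ^+ r) ->
  \sum_(0 <= r < m.+1) A r.+1 * ((1 - x ^+ (2 * r.+1)) * kern x 0 m.+1 r.+1) =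
  - ((-1) ^+ m / qfact (x ^+ 2) m) / (1 - x ^+ (2 * m).+1).
Proof.
move=> xP A0 A1 AS; rewrite -alt_sum_full //.
apply: (mulIf (xP (2 * m)%N)); rewrite divfK //.
rewrite big_distrl /=.
under eq_bigr => r _.
  rewrite -mulrA (mulrC _ (1 - x ^+ (2 * m).+1)) kern_contiguous //; over.
(* The two subtracted terms are the halves of the pairs A_(r+2) - x^(2r) A_r
   that the truncation at R leaves incomplete. *)
have partial R : \sum_(0 <= r < R.+1)
    A r.+1 * (kern x 0 m r - x ^+ (2 * r.+1) * kern x 0 m r.+2) =
  - alt_sum x m R - x ^+ (2 * R) * A R * kern x 0 m R.+1
                  - x ^+ (2 * R.+1) * A R.+1 * kern x 0 m R.+2.
  elim: R => [|R IHR].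
    by rewrite big_nat1 alt_sum0 A0 A1; ring.
  rewrite big_nat_recr //= IHR alt_sumS AS exprS.
  by move: ((-1) ^+ R) (x ^+ _) (x ^+ _) (x ^+ _) => a b c d; ring.
by rewrite partial !kern_gt // !mulr0 !subr0.
Qed.

(** Abel summation of [kern_split]: each value of the kernel relative to x
    receives one contribution from A_(r+1) and one from A_r. *)
Lemma sum_kern_split (F : fieldType) (x : F) (A : nat -> F) m :
  not_root_of_unity x -> A 0%N = 0 ->
  \sum_(0 <= r < m.+1) A r.+1 * ((1 - x ^+ (2 * r.+1)) * kern x 0 m.+1 r.+1) =
  - \sum_(0 <= r < m.+1) (x ^+ (2 * r) * A r - A r.+1) * kern x 1 m r.
Proof.
move=> xP A0.
have -> : \sum_(0 <= r < m.+1) A r.+1 * ((1 - x ^+ (2 * r.+1)) * kern x 0 m.+1 r.+1)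
  = \sum_(0 <= r < m.+1) (A r.+1 * kern x 1 m r)
    - \sum_(0 <= r < m.+1) (x ^+ (2 * r.+1) * A r.+1 * kern x 1 m r.+1).
  rewrite -sumrB; apply: eq_bigr => r _.
  by rewrite kern_split // mulrBr; congr (_ - _); rewrite mulrCA mulrA.
under [in RHS]eq_bigr => r _ do rewrite mulrBl.
rewrite sumrB opprB; congr (_ - _).
rewrite big_nat_recr //= kern_gt // mulr0 addr0.
by rewrite [in RHS]big_nat_recl //= A0 mulr0 mul0r add0r.
Qed.

(** * The weighted theta sums *)

Lemma big_zrange (V : nmodType) (f : int -> V) (lo : int) (k : nat) :
  \sum_(j <- zrange lo (lo + k%:Z - 1)) f j = \sum_(0 <= i < k) f (lo + i%:Z).
Proof.
rewrite /zrange; case: k => [|k].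
  by rewrite ifF ?big_nil ?big_geq //; lia.
rewrite ifT; last by lia.
have -> : `|(lo + k.+1%:Z - 1 - lo)%R|%N = k by lia.
by rewrite big_map.
Qed.

Lemma big_zrange_widen (V : nmodType) (f : int -> V) (lo hi : int) :
  lo <= hi + 1 ->
  \sum_(j <- zrange (lo - 1) (hi + 1)) f j =
  f (lo - 1) + \sum_(j <- zrange lo hi) f j + f (hi + 1).
Proof.
move=> le_lohi; have [k hi_def] : exists k : nat, hi = lo + k%:Z - 1.
  by exists `|(hi + 1 - lo)%R|%N; lia.
have -> : hi + 1 = (lo - 1) + k.+2%:Z - 1 by lia.
rewrite hi_def !big_zrange big_nat_recr //= big_nat_recl //= addr0.
congr (_ + _ + f _); last by lia.
by apply: eq_bigr => i _; congr f; lia.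
Qed.

(** The inner sums of both pairs: a_m without the factor 1 - x^(2m).  The two
    parities are interleaved so that one recurrence governs them. *)
Definition weighted_theta (F : fieldType) (x : F) (m : nat) : F :=
  let n := m./2%:Z in
  if odd m then - (x ^ (2 * n ^+ 2) * \sum_(j <- zrange (- n) n) x ^ (- 2 * j ^+ 2))
  else x ^ (2 * n ^+ 2 - 2 * n) *
       \sum_(j <- zrange (- n) (n - 1)) x ^ (- 2 * j ^+ 2 - 2 * j).

Lemma weighted_theta_even (F : fieldType) (x : F) n :
  weighted_theta x (2 * n) = x ^ (2 * n%:Z ^+ 2 - 2 * n%:Z) *
    \sum_(j <- zrange (- n%:Z) (n%:Z - 1)) x ^ (- 2 * j ^+ 2 - 2 * j).
Proof. by rewrite /weighted_theta mul2n odd_double doubleK. Qed.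

Lemma weighted_theta_odd (F : fieldType) (x : F) n :
  weighted_theta x (2 * n).+1 = - (x ^ (2 * n%:Z ^+ 2) *
    \sum_(j <- zrange (- n%:Z) n%:Z) x ^ (- 2 * j ^+ 2)).
Proof. by rewrite /weighted_theta mul2n /= odd_double uphalf_double. Qed.

Lemma weighted_theta0 (F : fieldType) (x : F) : weighted_theta x 0 = 0.
Proof. by rewrite -(muln0 2) weighted_theta_even big_nil mulr0. Qed.

Lemma weighted_theta1 (F : fieldType) (x : F) : weighted_theta x 1 = -1.
Proof. by rewrite -[1%N]/(2 * 0).+1 weighted_theta_odd big_seq1 mulr1. Qed.

(** Each of the two terms gained at the ends of the range of j has exponent
    exactly opposite to the outer power of x, so it contributes 1. *)
Lemma weighted_thetaSS (F : fieldType) (x : F) m : x != 0 ->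
  weighted_theta x m.+2 = x ^+ (2 * m) * weighted_theta x m + 2 * (-1) ^+ m.
Proof.
move=> x0; have [b [n ->]] : exists b n, m = (2 * n + nat_of_bool b)%N.
  by exists (odd m), m./2; lia.
have sgn : (-1) ^+ (2 * n) = 1 :> F by rewrite exprM sqrrN !expr1n.
have scale (k : nat) (a c : int) S : a = k%:Z + c ->
    x ^+ k * (x ^ c * S) = x ^ a * S.
  by move=> ->; rewrite exprnP expfzDr // mulrA.
have cancel (a c : int) : a + c = 0 -> x ^ a * x ^ c = 1.
  by rewrite -expfzDr // => ->.
have lo_step : - n.+1%:Z = - n%:Z - 1 by lia.
case: b => /=; rewrite ?addn1 ?addn0.
- have -> : ((2 * n).+3 = (2 * n.+1).+1)%N by lia.
  rewrite !weighted_theta_odd (exprS (-1)) sgn mulr1 lo_step.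
  have hi_step : n.+1%:Z = n%:Z + 1 by lia.
  rewrite [X in zrange _ X]hi_step big_zrange_widen; last by lia.
  rewrite !mulrDr !cancel; try lia.
  by rewrite mulrN (scale _ (2 * n.+1%:Z ^+ 2)); [ring | lia].
have -> : ((2 * n).+2 = 2 * n.+1)%N by lia.
rewrite !weighted_theta_even sgn mulr1 lo_step.
have hi_step : n.+1%:Z - 1 = (n%:Z - 1) + 1 by lia.
rewrite [X in zrange _ X]hi_step big_zrange_widen; last by lia.
rewrite !mulrDr !cancel; try lia.
by rewrite (scale _ (2 * n.+1%:Z ^+ 2 - 2 * n.+1%:Z)); [ring | lia].
Qed.

(** * The Bailey pairs *)

Lemma q_neq0 : q != 0.
Proof. by rewrite /q tofrac_eq0 polyX_eq0. Qed.

Lemma q_not_root_of_unity : not_root_of_unity q.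
Proof.
move=> k; rewrite /q -tofracXn -tofrac1 -tofracB tofrac_eq0 subr_eq0 eq_sym.
apply/eqP => /(congr1 (fun p : {poly rat} => size p)).
by rewrite size_polyXn size_poly1.
Qed.

Lemma qpoch_q n : qpoch q q n = qfact q n.
Proof. by apply: eq_bigr => j _; rewrite exprS. Qed.

Lemma qpoch_qq n : (1 - q) * qpoch (q * q) q n = qfact q n.+1.
Proof.
rewrite /qfact big_nat_recl //= expr1; congr (_ * _).
by apply: eq_bigr => j _; rewrite !exprS mulrA.
Qed.

Lemma b1S m :
  b1 m.+1 = - ((-1) ^+ m / qfact (q ^+ 2) m) / (1 - q ^+ (2 * m).+1).
Proof.
rewrite /b1 /= subSS subn0.
have -> : (2 * m.+1 - 1 = (2 * m).+1)%N by lia.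
rewrite qpoch_q; exact: (odd_qfact_ratio m q_not_root_of_unity).
Qed.

Lemma beta2_b1 n : beta2 n = - b1 n.+1.
Proof.
rewrite /beta2 /b1 /= subSS subn0.
have -> : (2 * n.+1 - 1 = 2 * n + 1)%N by lia.
by rewrite (exprS (-1)) mulN1r !mulNr opprK.
Qed.

Lemma a1_theta m : a1 m = (1 - q ^+ (2 * m)) * weighted_theta q m.
Proof.
rewrite /a1 /weighted_theta /a1_odd /a1_even; have := odd_double_half m.
case: (odd m) m./2 => n <-.
  have -> : q ^+ (2 * (true + n.*2)) = q ^ (4 * n%:Z + 2).
    by rewrite exprnP; congr (q ^ _); lia.
  have assocN (F : fieldType) (a b c : F) : - a * b * c = a * - (b * c) by ring.
  exact: assocN.
have -> : q ^+ (2 * (false + n.*2)) = q ^ (4 * n%:Z).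
  by rewrite exprnP; congr (q ^ _); lia.
symmetry; exact: mulrA.
Qed.

Lemma alpha2_theta m :
  alpha2 m = (q ^+ (2 * m) * weighted_theta q m - weighted_theta q m.+1) / (1 - q).
Proof.
have scale (k : nat) (a c : int) S : a = k%:Z + c ->
    q ^+ k * (q ^ c * S) = q ^ a * S.
  by move=> ->; rewrite exprnP expfzDr ?q_neq0 // mulrA.
have factor (F : fieldType) (a b c : F) : 1 / c * (a + b) = (a - - b) / c by ring.
have factorN (F : fieldType) (a b c : F) : - (1 / c) * (a + b) = (- a - b) / c.
  by ring.
rewrite /alpha2 /alpha2_odd /alpha2_even.
have := odd_double_half m; case: (odd m) m./2 => n <-.
  have -> : ((true + n.*2) = (2 * n).+1)%N by lia.
  have -> : ((2 * n).+2 = 2 * n.+1)%N by lia.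
  rewrite weighted_theta_odd weighted_theta_even factorN mulrN
    (scale _ (2 * n%:Z ^+ 2 + 4 * n%:Z + 2)).
    have -> : - n.+1%:Z = - n%:Z - 1 by lia.
    have -> : n.+1%:Z - 1 = n%:Z by lia.
    have -> : 2 * n.+1%:Z ^+ 2 - 2 * n.+1%:Z = 2 * n%:Z ^+ 2 + 2 * n%:Z by lia.
    by [].
  lia.
have -> : ((false + n.*2) = 2 * n)%N by lia.
rewrite weighted_theta_odd weighted_theta_even factor
  (scale _ (2 * n%:Z ^+ 2 + 2 * n%:Z)) //.
lia.
Qed.

Theorem theorem2p3 : bailey_pair 1 a1 b1 /\ bailey_pair q alpha2 beta2.
Proof.
have xP := q_not_root_of_unity.
have thetaSS r := weighted_thetaSS r q_neq0.
have pairing m :=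
  kern_pairing m xP (weighted_theta0 q) (weighted_theta1 q) thetaSS.
split=> n; last first.
  rewrite beta2_b1 b1S -pairing (sum_kern_split _ xP (weighted_theta0 q)) opprK.
  apply: eq_big_nat => r /andP[_]; rewrite ltnS => le_rn.
  rewrite alpha2_theta kernE // -qpoch_q addn1 -qpoch_qq.
  by rewrite -mulrA -invfM mulrCA.
case: n => [|m]; first by rewrite big_nat1 a1_theta weighted_theta0 mulr0 mul0r.
rewrite b1S -pairing [RHS]big_nat_recl //= a1_theta weighted_theta0 mulr0 mul0r add0r.
apply: eq_big_nat => r /andP[_]; rewrite ltnS => le_rm.
by rewrite a1_theta kernE // addn0 mul1r !qpoch_q mulrA (mulrC (weighted_theta _ _)).
Qed.
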